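(* Let $V$ be a finite-dimensional real vector space and let $\mathfrak{B}_1,\mathfrak{B}_2$ be two MASAs of $\mathfrak{gl}(V)$ such that $\dim V=\dim\mathfrak{B}_1=\dim\mathfrak{B}_2$. Then the Lie algebras $\mathfrak{B}_1\ltimes V$ and $\mathfrak{B}_2\ltimes V$ are isomorphic if and only if $\mathfrak{B}_1$ and $\mathfrak{B}_2$ are conjugate, i.e. there exists $\phi\in \mathrm{GL}(V)$ with $\mathfrak{B}_2=\phi\mathfrak{B}_1\phi^{-1}$. Moreover, a linear map $\psi:\mathfrak{B}_1\ltimes V\to\mathfrak{B}_2\ltimes V$ is a Lie algebra isomorphism if and only if there exists $(\phi_\psi,x_\psi)\in \mathrm{GL}(V)\times V$ such that $\phi_\psi\circ\mathfrak{B}_1\circ\phi_\psi^{-1}=\mathfrak{B}_2$ and, for every $(a,x)\in\mathfrak{B}_1\ltimes V$, $$\psi(a,x)=\big(\phi_\psi\circ a\circ\phi_\psi^{-1},\ \ \phi_\psi\circ a\circ\phi_\psi^{-1}(x_\psi)+\phi_\psi(x)\big).$$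
   Context: A subalgebra $\mathcal A$ of a Lie algebra $\mathcal G$ is a maximal Abelian subalgebra (MASA) of $\mathcal G$ if it equals its own centralizer $\{a\in\mathcal G : [a,\mathcal A]=0\}$ in $\mathcal G$. For an Abelian Lie subalgebra $\mathfrak{B}\subset\mathfrak{gl}(V)$, the semidirect sum $\mathfrak{B}\ltimes V$ is the vector space $\mathfrak{B}\oplus V$ with Lie bracket $[a,b]=0$, $[x,y]=0$, $[a,x]=a(x)$ for $a,b\in\mathfrak{B}$, $x,y\in V$. *)

(* Defs.v *)
From HB Require Import structures.
From mathcomp Require Import all_boot all_algebra reals.

Set Implicit Arguments.
Unset Strict Implicit.
Unset Printing Implicit Defensive.

Import GRing.Theory.
Local Open Scope ring_scope.

HB.mixin Record Vector_isLie (F : fieldType) L of Vector F L := {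
  lie : L -> L -> L;
  lieDl : forall x y z, lie (x + y) z = lie x z + lie y z;
  lieDr : forall x y z, lie x (y + z) = lie x y + lie x z;
  lieZl : forall (c : F) x y, lie (c *: x) y = c *: lie x y;
  lieZr : forall (c : F) x y, lie x (c *: y) = c *: lie x y;
  liexx : forall x, lie x x = 0;
  lie_jacobi : forall x y z,
    lie x (lie y z) + lie y (lie z x) + lie z (lie x y) = 0
}.

#[short(type="lieType")]
HB.structure Definition Lie (F : fieldType) :=
  {L of Vector F L & Vector_isLie F L}.

Section LieTheory.
Variables (F : fieldType) (L : lieType F).
Implicit Types (A : {vspace L}).

Definition subalgebra A : Prop := {in A &, forall a b, lie a b \in A}.

Definition centralizer A (a : L) : Prop := {in A, forall b, lie a b = 0}.

Definition lie_abelian A : Prop := {in A &, forall a b, lie a b = 0}.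

Definition masa A : Prop :=
  subalgebra A /\ (forall a, a \in A <-> centralizer A a).

Lemma masa_abelian A : masa A -> lie_abelian A.
Proof. by move=> [_ cA] a b /cA; apply. Qed.

End LieTheory.

Definition lie_iso (F : fieldType) (L1 L2 : lieType F) (psi : 'Hom(L1, L2)) :
    Prop :=
  bijective psi /\ (forall x y, psi (lie x y) = lie (psi x) (psi y)).

Definition lie_isomorphic (F : fieldType) (L1 L2 : lieType F) : Prop :=
  exists psi : 'Hom(L1, L2), lie_iso psi.

Definition gl (F : fieldType) (V : vectType F) := 'End(V).
HB.instance Definition _ (F : fieldType) (V : vectType F) :=
  Vector.copy (gl V) 'End(V).

Section GL.
Variables (F : fieldType) (V : vectType F).

Definition gl_bracket (a b : gl V) : gl V := (a \o b)%VF - (b \o a)%VF.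

Fact gl_bracketDl x y z :
  gl_bracket (x + y) z = gl_bracket x z + gl_bracket y z.
Proof.
by rewrite /gl_bracket comp_lfunDl comp_lfunDr opprD addrACA.
Qed.

Fact gl_bracketDr x y z :
  gl_bracket x (y + z) = gl_bracket x y + gl_bracket x z.
Proof.
by rewrite /gl_bracket comp_lfunDl comp_lfunDr opprD addrACA.
Qed.

Fact gl_bracketZl (c : F) x y : gl_bracket (c *: x) y = c *: gl_bracket x y.
Proof. by rewrite /gl_bracket scalerBr comp_lfunZl comp_lfunZr. Qed.

Fact gl_bracketZr (c : F) x y : gl_bracket x (c *: y) = c *: gl_bracket x y.
Proof. by rewrite /gl_bracket scalerBr comp_lfunZr comp_lfunZl. Qed.

Fact gl_bracketxx x : gl_bracket x x = 0.
Proof. exact: subrr. Qed.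

Fact gl_bracket_jacobi x y z :
  gl_bracket x (gl_bracket y z) + gl_bracket y (gl_bracket z x)
    + gl_bracket z (gl_bracket x y) = 0.
Proof.
rewrite /gl_bracket !(comp_lfunDl, comp_lfunDr, comp_lfunNl, comp_lfunNr).
rewrite !comp_lfunA !opprB (AC (2*2*2) (1*4*5*2*3*6)) /= !addrA !subrK.
exact: subrr.
Qed.

HB.instance Definition _ := Vector_isLie.Build F (gl V)
  gl_bracketDl gl_bracketDr gl_bracketZl gl_bracketZr gl_bracketxx
  gl_bracket_jacobi.

Definition is_GL (phi : 'End(V)) : Prop := bijective phi.

(* phi^-1%VF is the two-sided inverse of phi when phi is bijective. *)
Definition conj_lfun (phi a : 'End(V)) : gl V := (phi \o a \o phi^-1)%VF.

(* B2 = phi B1 phi^-1, as sets of endomorphisms *)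
Definition conj_by (phi : 'End(V)) (B1 B2 : {vspace gl V}) : Prop :=
  forall b, b \in B2 <-> exists2 a, a \in B1 & b = conj_lfun phi a.

Definition conjugate (B1 B2 : {vspace gl V}) : Prop :=
  exists2 phi, is_GL phi & conj_by phi B1 B2.

End GL.

(* Commutativity of B is what makes semi_bracket satisfy the Jacobi identity,
   hence the proof argument. *)
Definition semidirect (F : fieldType) (V : vectType F) (B : {vspace gl V})
  (cB : lie_abelian B) : Type := (subvs_of B * V)%type.

Section Semidirect.
Variables (F : fieldType) (V : vectType F) (B : {vspace gl V}).
Variable (cB : lie_abelian B).

HB.instance Definition _ := Vector.copy (semidirect cB) (subvs_of B * V)%type.

Definition semi_bracket (p q : semidirect cB) : semidirect cB :=
  (0, vsval p.1 q.2 - vsval q.1 p.2).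

Fact semi_bracketDl x y z :
  semi_bracket (x + y) z = semi_bracket x z + semi_bracket y z.
Proof.
by congr pair; rewrite /= ?addr0 // add_lfunE linearD opprD addrACA.
Qed.

Fact semi_bracketDr x y z :
  semi_bracket x (y + z) = semi_bracket x y + semi_bracket x z.
Proof.
by congr pair; rewrite /= ?addr0 // add_lfunE linearD opprD addrACA.
Qed.

Fact semi_bracketZl (c : F) x y :
  semi_bracket (c *: x) y = c *: semi_bracket x y.
Proof.
by congr pair; rewrite /= ?scaler0 // scale_lfunE linearZ scalerBr.
Qed.

Fact semi_bracketZr (c : F) x y :
  semi_bracket x (c *: y) = c *: semi_bracket x y.
Proof.
by congr pair; rewrite /= ?scaler0 // scale_lfunE linearZ scalerBr.
Qed.

Fact semi_bracketxx x : semi_bracket x x = 0.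
Proof. by rewrite /semi_bracket subrr. Qed.

Fact semi_bracket_jacobi x y z :
  semi_bracket x (semi_bracket y z) + semi_bracket y (semi_bracket z x)
    + semi_bracket z (semi_bracket x y) = 0.
Proof.
have cV (a b : subvs_of B) v :
    vsval a (vsval b v) = vsval b (vsval a v).
  have /eqP := cB (subvsP a) (subvsP b).
  by rewrite subr_eq0 => /eqP/lfunP/(_ v); rewrite !comp_lfunE.
rewrite /semi_bracket; congr pair; rewrite /= ?addr0 //.
rewrite !lfunE /= !subr0 !linearB /=.
rewrite (cV y.1 x.1) (cV z.1 x.1) (cV z.1 y.1) (AC 3 (1*3*2)) /= !addrA !subrK.
exact: subrr.
Qed.

HB.instance Definition _ := Vector_isLie.Build F (semidirect cB)
  semi_bracketDl semi_bracketDr semi_bracketZl semi_bracketZr semi_bracketxx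
  semi_bracket_jacobi.

End Semidirect.

(* Main.v *)
(** Since a MASA [B] of gl(V) contains the identity, the derived algebra of
    [B |x V] is [V], so an isomorphism [psi] maps [V] onto [V] by some
    [phi \in GL(V)].  Applying [psi] to [[a, x] = a x] shows that [psi] acts on
    the first component as conjugation by [phi], and applying it to
    [[a, \1] = 0] shows that the [V]-component of [psi (a, 0)] is the conjugate
    of [a] evaluated at [x0], the [V]-component of [psi (\1, 0)]. *)
From HB Require Import structures.
Require Import Defs.
From mathcomp Require Import all_boot all_algebra reals.

Set Implicit Arguments.
Unset Strict Implicit.
Unset Printing Implicit Defensive.

Import GRing.Theory.
Local Open Scope ring_scope.

Section Endomorphisms.
Variables (F : fieldType) (V : vectType F).
Implicit Types (phi a : 'End(V)) (B : {vspace gl V}).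

Lemma masa_id B : masa B -> (\1%VF : gl V) \in B.
Proof.
move=> [_ cB]; apply/cB => b _.
by rewrite /lie /= /gl_bracket comp_lfun1l comp_lfun1r subrr.
Qed.

Lemma is_GL_lker0 phi : is_GL phi <-> lker phi == 0%VS.
Proof.
split=> [/bij_inj/lker0P // | k0].
by exists (phi^-1)%VF; [apply: lker0_lfunK | apply: lker0_lfunVK].
Qed.

Lemma is_GL_lfunK phi : is_GL phi -> cancel phi (phi^-1)%VF.
Proof. by move/is_GL_lker0/lker0_lfunK. Qed.

Lemma is_GL_lfunVK phi : is_GL phi -> cancel (phi^-1)%VF phi.
Proof. by move/is_GL_lker0/lker0_lfunVK. Qed.

Lemma conj_lfunE phi a v : conj_lfun phi a v = phi (a ((phi^-1)%VF v)).
Proof. by rewrite /conj_lfun !comp_lfunE. Qed.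

Lemma conj_lfun_is_linear phi : linear (conj_lfun phi).
Proof.
move=> c a b.
by rewrite /conj_lfun comp_lfunDr comp_lfunDl -comp_lfunZr -comp_lfunZl.
Qed.

Lemma conj_lfun_inj phi : is_GL phi -> injective (conj_lfun phi).
Proof.
move=> Gphi a b /lfunP eq_ab; apply/lfunP => v.
apply: (bij_inj Gphi); have := eq_ab (phi v).
by rewrite !conj_lfunE is_GL_lfunK.
Qed.

End Endomorphisms.

Lemma semidirect_lieE (F : fieldType) (V : vectType F) (B : {vspace gl V})
    (cB : lie_abelian B) (p q : semidirect cB) :
  lie p q = (0, vsval p.1 q.2 - vsval q.1 p.2).
Proof. by []. Qed.

Section SemidirectIso.
Variables (F : fieldType) (V : vectType F) (B1 B2 : {vspace gl V}).
Variables (cB1 : lie_abelian B1) (cB2 : lie_abelian B2).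
Let L1 := semidirect cB1.
Let L2 := semidirect cB2.
Implicit Types (phi : 'End(V)) (psi : 'Hom(L1, L2)).

Definition semidirect_iso_form psi phi (x0 : V) : Prop :=
  forall (a : subvs_of B1) (x : V),
    vsval (psi (a, x)).1 = conj_lfun phi (vsval a) /\
    (psi (a, x)).2 = conj_lfun phi (vsval a) x0 + phi x.

(** Bijectivity comes from the triangular shape of the formula: the first component determines [a]
    by conjugation, and then the second determines [x] through [phi]. Brackets are preserved because
    the contributions of [x0] cancel, [B1] being commutative. *)
Lemma semidirect_iso_form_lie_iso psi phi x0 :
  is_GL phi -> conj_by phi B1 B2 -> semidirect_iso_form psi phi x0 ->
  lie_iso psi.
Proof.
move=> Gphi cphi psiE.
have k0 : lker psi == 0%VS.
  apply/lker0P => -[a x] [b y] eq_psi.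
  have [a1 a2] := psiE a x; have [b1 b2] := psiE b y.
  have eq_ab : a = b.
    by apply/val_inj/(conj_lfun_inj Gphi); rewrite -a1 -b1 eq_psi.
  congr (_, _) => //; apply: (bij_inj Gphi).
  by move: a2; rewrite eq_psi b2 eq_ab => /addrI.
have surj (q : L2) : q \in limg psi.
  case: q => b y; have [a aB1 bE] := (cphi _).1 (subvsP b).
  (* The preimage of [(b, y)] solves [b x0 + phi x = y] for [x]. *)
  have [p1 p2] := psiE (Subvs aB1) ((phi^-1)%VF (y - vsval b x0)).
  move: p1 p2; rewrite /= -bE is_GL_lfunVK // subrKC => p1 p2.
  rewrite (_ : (b, y) = psi (Subvs aB1, (phi^-1)%VF (y - vsval b x0))).
    exact/memv_img/memvf.
  by rewrite [RHS]surjective_pairing p2 (val_inj p1).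
split=> [|[a x] [b y]].
  exists (psi^-1)%VF; first exact: lker0_lfunK.
  by move=> q; apply: limg_lfunVK.
have [a1 a2] := psiE a x; have [b1 b2] := psiE b y.
(* The argument here is the bracket of [(a, x)] and [(b, y)]. *)
have [ab1 ab2] := psiE 0 (vsval a y - vsval b x).
rewrite !semidirect_lieE [LHS]surjective_pairing /=.
congr (_, _).
  by apply: val_inj; rewrite [LHS]ab1 /conj_lfun comp_lfun0r comp_lfun0l.
(* Used at [phi^-1 x0], this cancels the two terms in [x0] of the bracket of the images. *)
have cab v : vsval a (vsval b v) = vsval b (vsval a v).
  have /eqP := cB1 (subvsP a) (subvsP b).
  by rewrite subr_eq0 => /eqP/lfunP/(_ v); rewrite !comp_lfunE.
rewrite ab2 a1 b1 a2 b2 !conj_lfunE zero_lfunE linear0 add0r linearB !linearD /=.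
by rewrite !is_GL_lfunK // cab addrACA subrr add0r.
Qed.

(** The isomorphism is the one of the general form with [x0 = 0]. *)
Lemma conjugate_lie_isomorphic :
  conjugate B1 B2 -> lie_isomorphic L1 L2.
Proof.
move=> [phi Gphi cphi].
(* The projection [vsproj] only retypes the conjugate as an element of [B2], where it already lies
   by [cphi]; it keeps [f] visibly linear. *)
pose f (p : L1) : L2 := (vsproj B2 (conj_lfun phi (vsval p.1)), phi p.2).
have f_lin : linear f.
  move=> c [a x] [b y]; rewrite /f /=; congr (_, _); last exact: linearP.
  by rewrite conj_lfun_is_linear linearP.
pose fM := GRing.isLinear.Build _ _ _ _ f f_lin.
pose fL : {linear L1 -> L2} := HB.pack f fM.
exists (linfun fL).
apply: (@semidirect_iso_form_lie_iso _ phi 0 Gphi cphi) => a x.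
rewrite lfunE /= linear0 add0r vsprojK //.
by apply/cphi; exists (vsval a) => //; apply: subvsP.
Qed.

Hypothesis idB1 : (\1%VF : gl V) \in B1.

Lemma lie_iso_semidirect_iso_form psi :
  lie_iso psi -> exists phi x0,
  [/\ is_GL phi, conj_by phi B1 B2 & semidirect_iso_form psi phi x0].
Proof.
move=> [bij_psi psi_lie].
pose e : subvs_of B1 := Subvs idB1.
pose inV (x : V) : L1 := (0, x).
have inV_lin : linear inV.
  by move=> c x y; congr (_, _); rewrite /= scaler0 addr0.
(* The identity makes [(0, x)] a bracket, and every bracket in [L2] has first component zero. *)
have psiV1 x : (psi (inV x)).1 = 0.
  have -> : inV x = lie ((e, 0) : L1) (inV x).
    by rewrite semidirect_lieE /= id_lfunE linear0 subr0.
  by rewrite psi_lie.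
pose f x := (psi (inV x)).2.
have f_lin : linear f by move=> c x y; rewrite /f inV_lin linearP.
pose fM := GRing.isLinear.Build _ _ _ _ f f_lin.
pose fL : {linear V -> V} := HB.pack f fM.
pose phi : 'End(V) := linfun fL.
have phiE x : psi (inV x) = (0, phi x).
  by rewrite [LHS]surjective_pairing psiV1 lfunE.
have Gphi : is_GL phi.
  apply/is_GL_lker0/lker0P => x y eq_xy.
  have /(bij_inj bij_psi) : psi (inV x) = psi (inV y) by rewrite !phiE eq_xy.
  by case.
pose psiB (a : subvs_of B1) : L2 := psi (a, 0).
have psi_split a x : psi (a, x) = psiB a + psi (inV x).
  by rewrite -linearD; congr (psi (_, _)); rewrite /= ?addr0 ?add0r.
have psiB_phi a x : vsval (psiB a).1 (phi x) = phi (vsval a x).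
  have := psi_lie (a, 0) (inV x).
  have -> : lie ((a, 0) : L1) (inV x) = inV (vsval a x).
    by rewrite semidirect_lieE /= linear0 subr0.
  by rewrite !phiE => -[]; rewrite /= zero_lfunE subr0.
have psiB1 a : vsval (psiB a).1 = conj_lfun phi (vsval a).
  by apply/lfunP => v; rewrite conj_lfunE -psiB_phi is_GL_lfunVK.
have psi1 a x : vsval (psi (a, x)).1 = conj_lfun phi (vsval a).
  by rewrite psi_split phiE -psiB1 /= addr0.
exists phi, (psiB e).2; split=> // [b|a x].
  split=> [bB2|[a aB1 ->]]; last first.
    by rewrite -[a]/(vsval (Subvs aB1)) -psiB1 subvsP.
  (* If [(a, x)] is the preimage of [(b, 0)], then [b] is the conjugate of [a]. *)
  have [g _ psiK] := bij_psi.
  have := psiK ((Subvs bB2, 0) : L2); case: (g _) => a x psi_ax.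
  by exists (vsval a); rewrite ?subvsP // -(psi1 a x) psi_ax.
split; first exact: psi1.
have := psi_lie (a, 0) (e, 0).
have -> : lie ((a, 0) : L1) (e, 0) = 0.
  by rewrite semidirect_lieE /= linear0 id_lfunE subrr.
(* The second component of the vanishing bracket equates the conjugate of [a] at [(psiB e).2] with
   the conjugate of [\1] at [(psiB a).2], which is [(psiB a).2] itself. *)
rewrite linear0 => -[] /esym/eqP; rewrite subr_eq0 -/(psiB a) -/(psiB e) !psiB1.
rewrite (conj_lfunE _ \1%VF) id_lfunE is_GL_lfunVK // => /eqP ->.
by rewrite psi_split phiE.
Qed.

End SemidirectIso.

Theorem proposition3p1 (R : realType) (V : vectType R) (B1 B2 : {vspace gl V})
    (mB1 : masa B1) (mB2 : masa B2)
    (dB1 : \dim {:V} = \dim B1) (dB2 : \dim {:V} = \dim B2) :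
  let L1 := semidirect (masa_abelian mB1) in
  let L2 := semidirect (masa_abelian mB2) in
  (lie_isomorphic L1 L2 <-> conjugate B1 B2) /\
  (forall psi : 'Hom(L1, L2),
     lie_iso psi <->
     exists (phi : 'End(V)) (x0 : V),
       [/\ is_GL phi,
           conj_by phi B1 B2
         & forall (a : subvs_of B1) (x : V),
             vsval (psi (a, x)).1 = conj_lfun phi (vsval a) /\
             (psi (a, x)).2 = conj_lfun phi (vsval a) x0 + phi x]).
Proof.
move=> L1 L2; split; last first.
  move=> psi; split; first exact: lie_iso_semidirect_iso_form (masa_id mB1) psi.
  by move=> [phi [x0 [Gphi cphi]]]; apply: semidirect_iso_form_lie_iso.
split; last exact: conjugate_lie_isomorphic.
move=> [psi /(lie_iso_semidirect_iso_form (masa_id mB1))].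
by move=> [phi [x0 [Gphi cphi _]]]; exists phi.
Qed.
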